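(* Let $H$ be a complex Hilbert space, let $A\in B(H)$, let $\lambda,\mu\in\mathbb{C}$ and let $a,b>0$ be such that $\|A-\lambda I\|\leq a$ and $\|A^*-\mu I\|\leq b$. Then $$w^{2}(A)-w(A^{2})\leq \frac{a^{2}+b^{2}}{2}.$$
   Context: $B(H)$ denotes the algebra of all bounded linear operators on the complex Hilbert space $H$, $\|\cdot\|$ is the operator norm, and $I$ is the identity operator. The numerical radius of $A\in B(H)$ is $w(A)=\sup\{|\langle Ax,x\rangle| : x\in H,\ \|x\|=1\}$, and $w^2(A)$ means $(w(A))^2$. *)

(* Defs.v *)
From HB Require Import structures.
From mathcomp Require Import all_boot all_order all_algebra.
From mathcomp Require Import sesquilinear complex.
From mathcomp Require Import all_classical all_reals all_analysis.

Set Implicit Arguments.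
Unset Strict Implicit.
Unset Printing Implicit Defensive.

Import Order.TTheory GRing.Theory Num.Theory.
Import numFieldNormedType.Exports.

Local Open Scope ring_scope.
Local Open Scope classical_set_scope.

(* The inner product is linear in its first argument and conjugate-linear in
   its second one. *)
HB.mixin Record CompleteNormedModule_isHilbert (R : realType) H
    of CompleteNormedModule R[i] H := {
  inner : {dot H for Num.conj} ;
  sqr_norm_inner : forall x : H, `|x| ^+ 2 = inner x x
}.

#[short(type="hilbertType")]
HB.structure Definition Hilbert (R : realType) :=
  { H of CompleteNormedModule R[i] H & CompleteNormedModule_isHilbert R H }.

Section Operators.
Context {R : realType} {H : hilbertType R}.

(* Norms and moduli take their values in R[i]; being real, they are brought
   back to R by the real part. *)
Definition realnorm {V : normedZmodType R[i]} (x : V) : R := complex.Re `|x|.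

(* The sup over the unit ball is the operator norm as soon as f is a bounded
   linear operator. *)
Definition opnorm (f : H -> H) : R :=
  sup [set realnorm (f x) | x in [set x : H | realnorm x <= 1]].

(* For H = {0} the set is empty and its sup is 0. *)
Definition numradius (f : H -> H) : R :=
  sup [set realnorm (inner (f x) x) | x in [set x : H | realnorm x = 1]].

(* For every y, adjoint f y is the vector z, unique if it exists, such that
   <f x, y> = <x, z> for all x; for f linear and bounded it exists by the Riesz
   representation theorem. *)
Definition adjoint (f : H -> H) (y : H) : H :=
  get [set z : H | forall x : H, inner (f x) y = inner x z].

End Operators.

(* Main.v *)
Require Import Defs.
From HB Require Import structures.
From mathcomp Require Import all_boot all_order all_algebra.
From mathcomp Require Import sesquilinear complex.
From mathcomp Require Import all_classical all_reals all_analysis.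
From mathcomp Require Import ring lra.

Set Implicit Arguments.
Unset Strict Implicit.
Unset Printing Implicit Defensive.

Import Order.TTheory GRing.Theory Num.Theory.
Import numFieldNormedType.Exports.

Local Open Scope ring_scope.
Local Open Scope classical_set_scope.

(** For a unit vector x put c = <Ax, x> and y = Ax - c x, so that y is
    orthogonal to x. Then

      <A^2 x, x> - c^2 = <Ay, x> = <y, A^* x> = <y, A^* x - mu x>,

    and |y|^2 = <y, Ax - lambda x> gives |y| <= |Ax - lambda x| <= a. By
    Cauchy-Schwarz |c|^2 <= |<A^2 x, x>| + a b ([sqr_inner_le]); taking the
    supremum over x yields w(A)^2 <= w(A^2) + a b, and the AM-GM inequality
    concludes.

    The adjoint is specified by a choice operator, so it carries information
    only once a vector representing x |-> <Ax, y> is known to exist: this is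
    [riesz_representation]. Its proof minimises the energy
    J z = |z|^2 - 2 Re (f z), whose exact minimiser represents f. A point z
    where J exceeds its infimum by at most e^2 satisfies
    |f v - <v, z>| <= e |v| for all v ([approx_representer]); this estimate
    alone makes a minimising sequence Cauchy and passes to its limit. The step
    from J to this estimate and the Cauchy-Schwarz inequality are the same
    discriminant computation ([discriminant_le]).

    Norms and moduli are compared in R[i], where nonnegative numbers are real;
    only the suprema are taken in R. *)

(** * Cauchy-Schwarz inequality *)

(** A quadratic function of t that is nonnegative on the complex plane has a
    nonpositive discriminant: the minimum is reached at t = - w^* / N, and when
    N = 0 the function is affine in t, hence constant. *)
Lemma discriminant_le (C : numClosedFieldType) (d w N : C) :
    0 <= d -> 0 <= N ->
    (forall t : C, 0 <= d + (t * w + (t * w)^*) + `|t| ^+ 2 * N) ->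
  `|w| ^+ 2 <= d * N.
Proof.
move=> d0 N0 ge0.
have [->|w0] := eqVneq w 0; first by rewrite normr0 expr0n mulr_ge0.
have w2 : 0 < `|w| ^+ 2 by rewrite exprn_gt0 // normr_gt0.
(* Only the values t = - s w^* with s nonnegative matter. *)
have quad (s : C) : 0 <= s -> 0 <= d - 2 * s * `|w| ^+ 2 + s ^+ 2 * N * `|w| ^+ 2.
  move=> s0; have := ge0 (- (s * w^*)).
  have -> : - (s * w^*) * w = - (s * `|w| ^+ 2) by rewrite normCK; ring.
  have sw : s * `|w| ^+ 2 \is Num.real.
    by rewrite ger0_real // mulr_ge0 // exprn_ge0.
  rewrite (CrealP _) ?rpredN // normrN normrM norm_conjC (ger0_norm s0).
  by congr (0 <= _); ring.
have [N00|Nn0] := eqVneq N 0.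
  (* This s makes the affine function equal to - (d + 2). *)
  have := quad ((d + 1) / `|w| ^+ 2); rewrite N00 mulr0 mul0r addr0.
  have -> : d - 2 * ((d + 1) / `|w| ^+ 2) * `|w| ^+ 2 = - (d + 2).
    by field; rewrite normr_eq0.
  rewrite oppr_ge0 => H; have : d + 2 <= 0.
    by apply: H; rewrite divr_ge0 ?addr_ge0 // ltW.
  by rewrite lt_geF // ltr_wpDl.
have Np : 0 < N by rewrite lt_def Nn0.
have := quad N^-1; rewrite invr_ge0 => /(_ N0).
have -> : d - 2 * N^-1 * `|w| ^+ 2 + N^-1 ^+ 2 * N * `|w| ^+ 2 = d - `|w| ^+ 2 / N.
  by field.
by rewrite subr_ge0 ler_pdivrMr.
Qed.

Section InnerProduct.
Context {R : realType} {H : hilbertType R}.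
Implicit Types u v x y z : H.

Lemma inner_conj u v : inner u v = (inner v u)^*.
Proof. by rewrite hermC mul1r. Qed.

Lemma innerZr (k : R[i]) u v : inner u (k *: v) = k^* * inner u v.
Proof. exact: linearZr_LR. Qed.

Lemma innerZl (k : R[i]) u v : inner (k *: u) v = k * inner u v.
Proof. exact: linearZl_LR. Qed.

(** The quadratic function is t |-> |u + t v|^2. *)
Lemma CauchySchwarz_inner u v : `|inner u v| <= `|u| * `|v|.
Proof.
rewrite -(@ler_pXn2r _ 2) ?nnegrE ?mulr_ge0 // inner_conj norm_conjC exprMn.
apply: discriminant_le => [||t]; rewrite ?exprn_ge0 //.
rewrite -[X in 0 <= X](_ : `|u + t *: v| ^+ 2 = _) ?exprn_ge0 //.
rewrite sqr_norm_inner dnormD dnormZ -!sqr_norm_inner innerZr [inner u v]inner_conj.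
by rewrite -rmorphM conjCK; ring.
Qed.

(** Norm bounds that come from orthogonality or from adjointness are obtained
    by rewriting <u, u>. *)
Lemma norm_le_of_sqr (r : R[i]) u :
  0 <= r -> `|inner u u| <= r * `|u| -> `|u| <= r.
Proof.
move=> r0; have [->|u0] := eqVneq u 0; first by rewrite normr0.
by rewrite -sqr_norm_inner normrX normr_id expr2 ler_pM2r // normr_gt0.
Qed.

End InnerProduct.

(** * Riesz representation theorem *)

Section Riesz.
Context {R : realType} {H : hilbertType R}.
Context (f : H -> R[i]) (K : R[i]) (f_lin : scalar f) (K_ge0 : 0 <= K).
Context (f_bounded : forall v, `|f v| <= K * `|v|).

(** Equal to |z - z0|^2 - |z0|^2 when z0 represents f, so z0 is its unique
    minimiser. *)
Let energy (z : H) : R[i] := `|z| ^+ 2 - (f z + (f z)^*).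

Let energyD z t v : energy (z + t *: v) =
  energy z + (t * (inner v z - f v) + (t * (inner v z - f v))^*)
    + `|t| ^+ 2 * `|v| ^+ 2.
Proof.
have fD : f (z + t *: v) = f z + t * f v by rewrite addrC f_lin addrC.
rewrite /energy fD sqr_norm_inner dnormD dnormZ -!sqr_norm_inner.
rewrite innerZr [inner z v]inner_conj -rmorphM conjCK mulrBr !rmorphD rmorphN.
by ring.
Qed.

Let addJ_real (w : R[i]) : w + w^* \is Num.real.
Proof. by rewrite CrealE rmorphD /= conjCK addrC. Qed.

Let energy_real z : energy z \is Num.real.
Proof. by rewrite rpredB ?rpredX ?normr_real. Qed.

Let energy_ge z : - K ^+ 2 <= energy z.
Proof.
have fz : f z + (f z)^* <= 2 * (K * `|z|).
  apply: (le_trans (real_ler_norm (addJ_real _))).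
  apply: (le_trans (ler_normD _ _)).
  by rewrite norm_conjC mulrDl mul1r lerD.
rewrite -subr_ge0 [X in 0 <= X](_ : _ =
  (`|z| - K) ^+ 2 + (2 * (K * `|z|) - (f z + (f z)^*))); last first.
  by rewrite /energy; ring.
rewrite addr_ge0 ?subr_ge0 //.
by rewrite real_exprn_even_ge0 // rpredB ?normr_real ?ger0_real.
Qed.

(** A point z whose energy is within e^2 of the infimum will do: energy at
    z + t v, minus the infimum, is a nonnegative quadratic function of t with
    linear coefficient <v, z> - f v and constant term at most e^2. *)
Lemma approx_representer (e : R) : 0 < e ->
  exists z, forall v, `|f v - inner v z| <= e%:C%C * `|v|.
Proof.
move=> e0; pose E := [set complex.Re (energy z) | z in [set: H]].
have RE z : (complex.Re (energy z))%:C%C = energy z by rewrite RRe_real.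
have E_lb : has_lbound E.
  exists (complex.Re (- K ^+ 2)) => _ [z _ <-].
  by have := energy_ge z; rewrite lecE => /andP[].
have [||_ [z _ <-] ez] := @inf_adherent _ E (e ^+ 2).
- exact: exprn_gt0.
- by split => //; exists (complex.Re (energy 0)), 0.
have d_ge0 u : 0 <= energy u - (inf E)%:C%C.
  by rewrite subr_ge0 -RE lecR; apply: ge_inf => //; exists u.
exists z => v; have e_ge0 : 0 <= e%:C%C by rewrite ler0c ltW.
rewrite -(@ler_pXn2r _ 2) ?nnegrE ?mulr_ge0 // distrC exprMn.
apply: (@le_trans _ _ ((energy z - (inf E)%:C%C) * `|v| ^+ 2)).
  apply: discriminant_le => [||t]; rewrite ?exprn_ge0 //.
  rewrite -[X in 0 <= X](_ : energy (z + t *: v) - (inf E)%:C%C = _) //.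
  by rewrite energyD; ring.
rewrite ler_wpM2r ?exprn_ge0 // lerBlDl -RE -rmorphXn -rmorphD lecR.
exact: ltW.
Qed.

(** Two approximate representers u, u' with errors e, e' satisfy
    |<v, u - u'>| <= (e + e') |v|; for v = u - u' this bounds |u - u'| by
    e + e', so representers with errors 1 / (n + 1) form a Cauchy sequence. *)
Lemma riesz_representation : exists z, forall v, f v = inner v z.
Proof.
have inv_gt0 n : 0 < n.+1%:R^-1 :> R by rewrite invr_gt0 ltr0n.
have [u uP] := choice (fun n => approx_representer (inv_gt0 n)).
have near_u (e : R) : 0 < e -> \forall n \near \oo, forall v,
    `|f v - inner v (u n)| <= e%:C%C * `|v|.
  move=> e0; have := near_infty_natSinv_lt (PosNum e0).
  apply: filterS => n ne v; apply: le_trans (uP n v) _.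
  by rewrite ler_wpM2r // lecR ltW.
(* Radii of balls in H are elements of R[i]. *)
have real_pos (e : R[i]) : 0 < e -> exists2 r : R, 0 < r & r%:C%C = e.
  move=> e0; exists (complex.Re e); last by rewrite RRe_real ?gtr0_real.
  by rewrite -ltcR RRe_real ?gtr0_real.
have u_cvg : cvg (u @ \oo).
  apply: cauchy_cvg; apply: cauchy_exP => _ /real_pos[r r0 <-].
  have r4 : 0 < r / 4 by rewrite divr_gt0.
  have [N _ NP] := near_u _ r4.
  exists (u N), N => // n /= Nn.
  rewrite -ball_normE /ball_ /=.
  apply: (@le_lt_trans _ _ (r / 2)%:C%C); last first.
    by rewrite ltcR ltr_pdivrMr // ltr_pMr // ltr1n.
  (* Compare u N and u n through the value of f at their difference. *)
  apply: norm_le_of_sqr; first by rewrite ler0c divr_ge0 // ltW.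
  rewrite linearBr -(subrKA (f (u N - u n))).
  apply: (le_trans (ler_normD _ _)).
  rewrite [X in _ <= X](_ : _ =
      (r / 4)%:C%C * `|u N - u n| + (r / 4)%:C%C * `|u N - u n|).
    by rewrite lerD ?NP //= distrC; apply: NP => /=.
  by rewrite -mulrDl -rmorphD; congr (_%:C%C * _); field.
pose z := lim (u @ \oo).
exists z => v; apply/eqP; rewrite -subr_eq0 -normr_le0.
apply/ler_addgt0Pl => e e0; rewrite addr0.
(* An error r for u n and for its distance to z costs 2 r |v| <= e; adding 1
   to |v| covers v = 0. *)
have v1 : 0 < `|v| + 1 by rewrite ltr_wpDl.
have s0 : 0 < e / (2 * (`|v| + 1)) by rewrite divr_gt0 ?mulr_gt0.
have [r r0 rE] := real_pos _ s0.
have [n [un zn]] : exists n, (forall w, `|f w - inner w (u n)| <= r%:C%C * `|w|)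
    /\ `|z - u n| <= r%:C%C.
  have zP : \forall n \near \oo, `|z - u n| <= r%:C%C.
    by move/cvgrPdist_le : u_cvg; apply; rewrite rE.
  have [n np] := filter_ex (filterI (near_u _ r0) zP).
  by exists n.
rewrite -(subrKA (inner v (u n))) -linearBr /=.
apply: (le_trans (ler_normD _ _)).
apply: (@le_trans _ _ (r%:C%C * `|v| + `|v| * r%:C%C)).
  apply: lerD => //; apply: (le_trans (CauchySchwarz_inner _ _)).
  by rewrite ler_wpM2l // distrC.
rewrite rE [X in X <= _](_ : _ = e * (`|v| / (`|v| + 1))); last first.
  by field; rewrite gt_eqF.
by rewrite ler_piMr ?(ltW e0) // ler_pdivrMr // mul1r lerDl.
Qed.

End Riesz.

(** * Adjoint of a bounded operator *)

Section Adjoint.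
Context {R : realType} {H : hilbertType R}.
Context (A : {linear H -> H}) (K : R[i]) (K_ge0 : 0 <= K).
Context (A_le : forall x, `|A x| <= K * `|x|).

(** The Riesz theorem applied to x |-> <Ax, y>, bounded by K |y|. *)
Lemma inner_adjoint x y : inner (A x) y = inner x (adjoint A y).
Proof.
suff /getPex : exists z, forall x, inner (A x) y = inner x z by apply.
apply: (@riesz_representation _ _ _ (K * `|y|)) => [k u v||v].
- by rewrite linearP linearDl /= innerZl.
- by rewrite mulr_ge0.
by rewrite (le_trans (CauchySchwarz_inner _ _)) // mulrAC ler_wpM2r.
Qed.

(** |A^* y|^2 = <A A^* y, y> <= K |A^* y| |y|. *)
Lemma norm_adjoint_le y : `|adjoint A y| <= K * `|y|.
Proof.
apply: norm_le_of_sqr; first by rewrite mulr_ge0.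
rewrite -inner_adjoint (le_trans (CauchySchwarz_inner _ _)) //.
by rewrite mulrAC ler_wpM2r.
Qed.

End Adjoint.

(** * Operator norm and numerical radius as suprema *)

Section Suprema.
Context {R : realType} {H : hilbertType R}.
Implicit Types (f : H -> H) (x : H).

Lemma realnormE (V : normedZmodType R[i]) (v : V) : (realnorm v)%:C%C = `|v|.
Proof. by rewrite RRe_real ?normr_real. Qed.

Lemma realnorm_le (V : normedZmodType R[i]) (v : V) (r : R) :
  (realnorm v <= r) = (`|v| <= r%:C%C).
Proof. by rewrite -realnormE lecR. Qed.

(** The a priori bound K makes the supremum that defines the operator norm
    meaningful: an unbounded set has supremum 0. *)
Lemma norm_le_opnorm f (K : R[i]) x :
  (forall y, `|f y| <= K * `|y|) -> 0 <= K -> `|x| <= 1 -> `|f x| <= (opnorm f)%:C%C.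
Proof.
move=> fK K0 x1; rewrite -realnorm_le; apply: ub_le_sup; last first.
  by exists x => //=; rewrite realnorm_le.
exists (complex.Re K) => _ [y /= y1 <-].
rewrite realnorm_le RRe_real ?ger0_real // (le_trans (fK y)) //.
by rewrite ler_piMr // -realnorm_le.
Qed.

Lemma norm_inner_le_numradius f (K : R[i]) x :
  (forall y, `|f y| <= K * `|y|) -> 0 <= K -> `|x| = 1 ->
  `|inner (f x) x| <= (numradius f)%:C%C.
Proof.
move=> fK K0 x1; rewrite -realnorm_le; apply: ub_le_sup; last first.
  by exists x => //=; rewrite /realnorm x1.
exists (complex.Re K) => _ [y /= y1 <-].
have {}y1 : `|y| = 1 by rewrite -realnormE y1.
rewrite realnorm_le RRe_real ?ger0_real // (le_trans (CauchySchwarz_inner _ _)) //.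
by have := fK y; rewrite y1 !mulr1.
Qed.

(** In the zero space there is no unit vector and the numerical radius is 0,
    hence the sign condition on r. *)
Lemma numradius_le f (r : R) : 0 <= r ->
  (forall x, `|x| = 1 -> `|inner (f x) x| <= r%:C%C) -> numradius f <= r.
Proof.
move=> r0 fr; rewrite /numradius.
set E := [set _ | _ in _].
have [->|/set0P E0] := eqVneq E set0; first by rewrite sup0.
apply: ge_sup => // _ [x /= x1 <-].
by rewrite realnorm_le fr // -realnormE x1.
Qed.

Lemma numradius_ge0 f : 0 <= numradius f.
Proof.
rewrite /numradius; set E := [set _ | _ in _].
have [E_sup|/sup_out-> //] := pselect (has_sup E).
have [r Er] := E_sup.1; apply: (@le_trans _ _ r); last exact: sup_upper_bound.
by case: Er => x _ <-; rewrite -lecR realnormE normr_ge0.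
Qed.

End Suprema.

(** * The inequality at a unit vector *)

Section UnitVector.
Context {R : realType} {H : hilbertType R}.

(** With c = <Ax, x> and y = Ax - c x orthogonal to x, the difference
    <A^2 x, x> - c^2 equals <y, A^* x - mu x>, and subtracting multiples of x
    from Ax does not change <y, Ax>, so that |y| <= a. *)
Lemma sqr_inner_le (A : {linear H -> H}) (K lambda mu a b : R[i]) (x : H) :
    0 <= K -> (forall y, `|A y| <= K * `|y|) -> `|x| = 1 ->
    `|A x - lambda *: x| <= a -> `|adjoint A x - mu *: x| <= b ->
  `|inner (A x) x| ^+ 2 <= `|inner (A (A x)) x| + a * b.
Proof.
move=> K0 A_le x1 xa xb.
pose c := inner (A x) x; pose y := A x - c *: x.
have xx : inner x x = 1 by rewrite -sqr_norm_inner x1 expr1n.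
have yx : inner y x = 0 by rewrite linearBl /= innerZl xx mulr1 subrr.
have ya : `|y| <= a.
  apply: norm_le_of_sqr; first exact: le_trans xa.
  have -> : inner y y = inner y (A x - lambda *: x).
    by rewrite {2}/y !linearBr /= !innerZr yx !mulr0.
  by rewrite (le_trans (CauchySchwarz_inner _ _)) // mulrC ler_wpM2r.
have Ay : inner (A (A x)) x - c ^+ 2 = inner y (adjoint A x - mu *: x).
  rewrite linearBr /= innerZr yx mulr0 subr0 -(inner_adjoint K0 A_le).
  have -> : A y = A (A x) - c *: A x by rewrite linearB linearZ.
  by rewrite linearBl /= innerZl.
rewrite -/c -normrX -[c ^+ 2](subKr (inner (A (A x)) x)) Ay.
rewrite (le_trans (ler_normB _ _)) // lerD2l.
by rewrite (le_trans (CauchySchwarz_inner _ _)) // ler_pM.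
Qed.

End UnitVector.

Theorem mainTheorem2 (R : realType) (H : hilbertType R)
    (A : {linear H -> H}) (A_bounded : bounded_near A (nbhs (0 : H)))
    (lambda mu : R[i]) (a b : R) (a_gt0 : 0 < a) (b_gt0 : 0 < b)
    (A_lambda : opnorm (A \- lambda \*: idfun) <= a)
    (A_mu : opnorm (adjoint A \- mu \*: idfun) <= b) :
  numradius A ^+ 2 - numradius (A \o A) <= (a ^+ 2 + b ^+ 2) / 2.
Proof.
have [K K_ge0 A_le] : exists2 K : R[i], 0 <= K & forall x, `|A x| <= K * `|x|.
  have K_gt0 := nbhs_pinfty_gt (real0 R[i]).
  have [K [A_le K0]] := filter_ex (filterI ((linear_boundedP A).1 A_bounded) K_gt0).
  by exists K => //; apply: ltW.
have scale_le (B : H -> H) (k : R[i]) : (forall x, `|B x| <= K * `|x|) ->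
    forall x, `|(B \- k \*: idfun) x| <= (K + `|k|) * `|x|.
  move=> B_le x /=; rewrite (le_trans (ler_normB _ _)) // normrZ mulrDl.
  by rewrite lerD2r.
have AA_le x : `|(A \o A) x| <= K ^+ 2 * `|x|.
  by rewrite /= expr2 -mulrA (le_trans (A_le _)) // ler_wpM2l.
set w2 := numradius (A \o A).
have w2_ge0 : 0 <= w2 := numradius_ge0 _.
have ab_ge0 : 0 <= a * b by rewrite mulr_ge0 ?ltW.
have wA : numradius A <= Num.sqrt (w2 + a * b).
  apply: numradius_le => [|x x1]; first exact: sqrtr_ge0.
  rewrite -(@ler_pXn2r _ 2) ?nnegrE ?normr_ge0 ?ler0c ?sqrtr_ge0 //.
  have -> : (Num.sqrt (w2 + a * b))%:C%C ^+ 2 = w2%:C%C + a%:C%C * b%:C%C.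
    by rewrite -rmorphXn -rmorphM -rmorphD /= sqr_sqrtr ?addr_ge0.
  have Kk k : 0 <= K + `|k : R[i]| by rewrite addr_ge0.
  have x_le1 : `|x| <= 1 by rewrite x1.
  apply: (le_trans (sqr_inner_le (lambda := lambda) (mu := mu)
      (a := a%:C%C) (b := b%:C%C) K_ge0 A_le x1 _ _)).
  - apply: le_trans (norm_le_opnorm (scale_le _ lambda A_le) (Kk _) x_le1) _.
    by rewrite lecR.
  - have As_le := norm_adjoint_le K_ge0 A_le.
    apply: le_trans (norm_le_opnorm (scale_le _ mu As_le) (Kk _) x_le1) _.
    by rewrite lecR.
  rewrite lerD2r; apply: norm_inner_le_numradius AA_le _ x1.
  exact: exprn_ge0.
have : numradius A ^+ 2 <= w2 + a * b.
  rewrite -[leRHS]sqr_sqrtr ?addr_ge0 //.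
  by rewrite ler_pXn2r ?nnegrE ?sqrtr_ge0 ?numradius_ge0.
(* AM-GM: a b <= (a^2 + b^2) / 2. *)
have := sqr_ge0 (a - b); nra.
Qed.
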